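(* Let $M$ be a smooth manifold of dimension $n\ge 3$, and let $g(t)$, $t\in I$ ($I$ an interval), be a smooth family of Riemannian metrics on $M$ solving the Ricci flow $\frac{\partial g_{ij}}{\partial t}=-2R_{ij}$, whose scalar curvature $R$ is nowhere zero. Let $R_{ijkl}$, $C_{ijkl}$ and $L_{ijkl}$ denote the components, in a fixed (time-independent) coordinate system, of the Riemann curvature tensor, the concircular curvature tensor and the conharmonic curvature tensor of $g(t)$. Then $$\frac{\partial}{\partial t}\left(\frac{C_{ijkl}-R_{ijkl}}{R}\right)=\frac{2(n-2)}{n(n-1)}\left[R_{ijkl}-L_{ijkl}\right].$$
   Context: $R_{ijkl}$ is the $(0,4)$ Riemann curvature tensor, $R_{ij}$ the Ricci tensor and $R$ the scalar curvature of $g$; the index convention used here is that $R_{il}=g^{jk}R_{ijkl}$, so that a metric of constant sectional curvature $K$ has $R_{ijkl}=K(g_{il}g_{jk}-g_{ik}g_{jl})$. The concircular curvature tensor is $$C_{ijkl}=R_{ijkl}-\frac{R}{n(n-1)}\left[g_{il}g_{jk}-g_{jl}g_{ik}\right].$$ The conharmonic curvature tensor is $$L_{ijkl}=R_{ijkl}-\frac{1}{n-2}\left[g_{jk}R_{il}+g_{il}R_{jk}-g_{ik}R_{jl}-g_{jl}R_{ik}\right].$$ *)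

(* Defs.v *)
From HB Require Import structures.
From mathcomp Require Import all_boot all_order all_algebra.
From mathcomp Require Import all_classical all_reals all_analysis.

Set Implicit Arguments.
Unset Strict Implicit.
Unset Printing Implicit Defensive.

Import Order.TTheory GRing.Theory Num.Theory.
Import numFieldNormedType.Exports.

Local Open Scope classical_set_scope.
Local Open Scope ring_scope.

Definition partial (R : realType) (n : nat) (i : 'I_n) (f : 'rV[R]_n -> R)
    (x : 'rV[R]_n) : R :=
  'D_(delta_mx 0 i) f x.

(* The difference quotient is restricted to I, so at an endpoint of an interval
   I this is the one-sided derivative. *)
Definition has_deriv_within (R : realType) (I : set R) (f : R -> R)
    (t l : R) : Prop :=
  (fun s => (s - t)^-1 * (f s - f t)) @ within I t^' --> l.

(* U is meant to be open. *)
Fixpoint Ck_on (R : realType) (n k : nat) (U : set 'rV[R]_n)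
    (f : 'rV[R]_n -> R) : Prop :=
  {within U, continuous f} /\
  match k with
  | 0 => True
  | k'.+1 => forall i : 'I_n,
      (forall x, U x -> derivable f x (delta_mx 0 i)) /\
      Ck_on k' U (partial i f)
  end.

Definition smooth_on (R : realType) (n : nat) (U : set 'rV[R]_n)
    (f : 'rV[R]_n -> R) : Prop :=
  forall k, Ck_on k U f.

(* Joint regularity in (t, x) on I x U, for an interval I which may contain
   its endpoints and an open U: all mixed partial derivatives of order at most
   k exist and are continuous on I x U. *)
Fixpoint Ck_in_time (R : realType) (n k : nat) (I : set R) (U : set 'rV[R]_n)
    (f : R -> 'rV[R]_n -> R) : Prop :=
  {within I `*` U, continuous (fun p : R * 'rV[R]_n => f p.1 p.2)} /\
  match k with
  | 0 => True
  | k'.+1 =>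
      (forall i : 'I_n,
        (forall t x, I t -> U x -> derivable (f t) x (delta_mx 0 i)) /\
        Ck_in_time k' I U (fun t => partial i (f t))) /\
      (exists2 f' : R -> 'rV[R]_n -> R,
        forall t x, I t -> U x -> has_deriv_within I (f^~ x) t (f' t x) &
        Ck_in_time k' I U f')
  end.

Definition smooth_in_time (R : realType) (n : nat) (I : set R)
    (U : set 'rV[R]_n) (f : R -> 'rV[R]_n -> R) : Prop :=
  forall k, Ck_in_time k I U f.

(* Only the values of coord on dom and of coord_inv on coord @` dom matter. *)
Record chart (R : realType) (n : nat) (M : topologicalType) : Type := Chart {
  dom : set M ;
  coord : M -> 'rV[R]_n ;
  coord_inv : 'rV[R]_n -> M ;
  dom_open : open dom ;
  coord_image_open : open (coord @` dom) ;
  coordK : forall p, dom p -> coord_inv (coord p) = p ;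
  coord_continuous : {within dom, continuous coord} ;
  coord_inv_continuous : {within coord @` dom, continuous coord_inv}
}.

Definition chart_image (R : realType) (n : nat) (M : topologicalType)
    (c : chart R n M) : set 'rV[R]_n :=
  coord c @` dom c.

Definition transition (R : realType) (n : nat) (M : topologicalType)
    (c d : chart R n M) (k : 'I_n) (x : 'rV[R]_n) : R :=
  coord d (coord_inv c x) 0 k.

Definition smooth_transition (R : realType) (n : nat) (M : topologicalType)
    (c d : chart R n M) : Prop :=
  forall k, smooth_on (coord c @` (dom c `&` dom d)) (transition c d k).

Definition compatible (R : realType) (n : nat) (M : topologicalType)
    (c d : chart R n M) : Prop :=
  smooth_transition c d /\ smooth_transition d c.

(* A is a maximal smooth atlas; its elements are all the coordinate systems of
   the n-dimensional smooth manifold M. *)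
Record smooth_manifold (R : realType) (n : nat) (M : topologicalType)
    (A : set (chart R n M)) : Prop := SmoothManifold {
  manifold_hausdorff : hausdorff_space M ;
  manifold_second_countable : @second_countable M ;
  atlas_cover : forall p, exists2 c, A c & dom c p ;
  atlas_compatible : forall c d, A c -> A d -> compatible c d ;
  atlas_maximal : forall c, (forall d, A d -> compatible c d) -> A c
}.

(* A time-dependent (0,2)-tensor field is given by its components: g c t x i j
   is g(t)_ij in the chart c at the point with coordinates x. *)
Record smooth_metric_family (R : realType) (n : nat) (M : topologicalType)
    (A : set (chart R n M)) (I : set R)
    (g : chart R n M -> R -> 'rV[R]_n -> 'M[R]_n) : Prop :=
    SmoothMetricFamily {
  metric_smooth : forall c (i j : 'I_n), A c ->
    smooth_in_time I (chart_image c) (fun t x => g c t x i j) ;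
  metric_sym : forall c t x, A c -> I t -> chart_image c x ->
    (g c t x)^T = g c t x ;
  metric_posdef : forall c t x (v : 'rV[R]_n),
    A c -> I t -> chart_image c x -> v != 0 ->
    0 < (v *m g c t x *m v^T) 0 0 ;
  metric_change : forall c d t p (i j : 'I_n),
    A c -> A d -> I t -> dom c p -> dom d p ->
    g c t (coord c p) i j =
      \sum_(k < n) \sum_(l < n)
        partial i (transition c d k) (coord c p) *
        partial j (transition c d l) (coord c p) *
        g d t (coord d p) k l
}.

Section Curvature.
Variables (R : realType) (n : nat).
(* components of a metric in one coordinate system *)
Variable h : 'rV[R]_n -> 'M[R]_n.
Implicit Types (x : 'rV[R]_n) (i j k l m : 'I_n).

(* Gamma^m_ij *)
Definition christoffel m i j x : R :=
  2^-1 * \sum_(l < n) invmx (h x) m l *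
    (partial i (fun y => h y j l) x + partial j (fun y => h y i l) x
     - partial l (fun y => h y i j) x).

(* R_ijk^m, where (D_i D_j - D_j D_i) e_k = R_ijk^m e_m for the Levi-Civita
   connection D and the coordinate fields e_k *)
Definition riemann13 x i j k m : R :=
  partial i (christoffel m j k) x - partial j (christoffel m i k) x
  + \sum_(p < n) (christoffel p j k x * christoffel m i p x
                  - christoffel p i k x * christoffel m j p x).

(* With this sign, a metric of constant sectional curvature K has
   R_ijkl = K (g_il g_jk - g_ik g_jl). *)
Definition riemann x i j k l : R :=
  \sum_(m < n) h x l m * riemann13 x i j k m.

Definition ricci x i l : R :=
  \sum_(j < n) \sum_(k < n) invmx (h x) j k * riemann x i j k l.

Definition scalar_curvature x : R :=
  \sum_(i < n) \sum_(l < n) invmx (h x) i l * ricci x i l.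

Definition concircular x i j k l : R :=
  riemann x i j k l
  - scalar_curvature x / (n%:R * (n%:R - 1)) *
    (h x i l * h x j k - h x j l * h x i k).

Definition conharmonic x i j k l : R :=
  riemann x i j k l
  - (n%:R - 2)^-1 *
    (h x j k * ricci x i l + h x i l * ricci x j k
     - h x i k * ricci x j l - h x j l * ricci x i k).

End Curvature.

Definition ricci_flow (R : realType) (n : nat) (M : topologicalType)
    (A : set (chart R n M)) (I : set R)
    (g : chart R n M -> R -> 'rV[R]_n -> 'M[R]_n) : Prop :=
  forall c t x (i j : 'I_n), A c -> I t -> chart_image c x ->
    has_deriv_within I (fun s => g c s x i j) t (- 2 * ricci (g c t) x i j).

(* Main.v *)
Require Import Defs.
From mathcomp Require Import all_boot all_order all_algebra.
From mathcomp Require Import all_classical all_reals all_analysis.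
From mathcomp Require Import ring.

Import Order.TTheory GRing.Theory Num.Theory.
Import numFieldNormedType.Exports.

Local Open Scope classical_set_scope.
Local Open Scope ring_scope.

(** Wherever the scalar curvature is nonzero, it cancels from the quotient
    (C_ijkl - R_ijkl) / R, because the two tensors differ by the scalar
    curvature times an expression in the metric alone:

      (C_ijkl - R_ijkl) / R = - (g_il g_jk - g_jl g_ik) / (n (n - 1)).

    Hence no evolution equation of a curvature is involved: the product rule
    and dg/dt = -2 Ric give the derivative of the right-hand side as

      2 / (n (n - 1)) * (g_jk R_il + g_il R_jk - g_ik R_jl - g_jl R_ik),

    and by the definition of the conharmonic tensor the second factor is
    (n - 2) (R_ijkl - L_ijkl).  The product rule for derivatives within a set
    is [has_deriv_withinM]; the cancellation is [concircular_quotient]. *)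

Section DerivWithin.
Set Implicit Arguments.
Variables (R : realType) (I : set R).
Implicit Types (f u v : R -> R) (t a b : R).

Lemma has_deriv_within_eq f u t a : I t -> (forall s, I s -> u s = f s) ->
  has_deriv_within I f t a -> has_deriv_within I u t a.
Proof.
move=> It uf; rewrite /has_deriv_within; apply: cvg_trans.
apply: near_eq_cvg; rewrite near_withinE; near=> s => Is.
by rewrite !uf.
Unshelve. all: by end_near. Qed.

(** The difference f s - f t is s - t, which tends to 0, times a convergent
    difference quotient. *)
Lemma has_deriv_within_cvg f t a : has_deriv_within I f t a ->
  f s @[s --> within I t^'] --> f t.
Proof.
move=> df.
have st : s - t @[s --> within I t^'] --> (0 : R).
  rewrite -(subrr t); apply: cvgB; last exact: cvg_cst.
  exact: cvg_trans (cvg_within _) (cvg_within _).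
have : f t + (s - t) * ((s - t)^-1 * (f s - f t)) @[s --> within I t^']
    --> f t + 0 * a.
  by apply: cvgD; [exact: cvg_cst | exact: cvgM].
rewrite mul0r addr0; apply: cvg_trans; apply: near_eq_cvg.
rewrite 2!near_withinE; near=> s => /= s_neq_t _.
by rewrite mulVKf ?subr_eq0// addrC subrK.
Unshelve. all: by end_near. Qed.

Lemma has_deriv_withinM u v t a b :
  has_deriv_within I u t a -> has_deriv_within I v t b ->
  has_deriv_within I (fun s => u s * v s) t (a * v t + u t * b).
Proof.
move=> du dv; rewrite /has_deriv_within.
have : (s - t)^-1 * (u s - u t) * v s + u t * ((s - t)^-1 * (v s - v t))
    @[s --> within I t^'] --> a * v t + u t * b.
  apply: cvgD; first by apply: cvgM => //; exact: has_deriv_within_cvg dv.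
  by apply: cvgM => //; exact: cvg_cst.
by apply: cvg_trans; apply: near_eq_cvg; near=> s => /=; ring.
Unshelve. all: by end_near. Qed.

Lemma has_deriv_withinB u v t a b :
  has_deriv_within I u t a -> has_deriv_within I v t b ->
  has_deriv_within I (fun s => u s - v s) t (a - b).
Proof.
move=> du dv; rewrite /has_deriv_within.
have : (s - t)^-1 * (u s - u t) - (s - t)^-1 * (v s - v t)
    @[s --> within I t^'] --> a - b by exact: cvgB.
by apply: cvg_trans; apply: near_eq_cvg; near=> s => /=; ring.
Unshelve. all: by end_near. Qed.

Lemma has_deriv_withinZ r u t a :
  has_deriv_within I u t a -> has_deriv_within I (fun s => r * u s) t (r * a).
Proof.
move=> du; rewrite /has_deriv_within.
have : r * ((s - t)^-1 * (u s - u t)) @[s --> within I t^'] --> r * a.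
  by apply: cvgM => //; exact: cvg_cst.
by apply: cvg_trans; apply: near_eq_cvg; near=> s => /=; ring.
Unshelve. all: by end_near. Qed.

End DerivWithin.

Section CurvatureAlgebra.
Set Implicit Arguments.
Variables (R : realType) (n : nat) (h : 'rV[R]_n -> 'M[R]_n) (x : 'rV[R]_n).
Implicit Types i j k l : 'I_n.

Lemma concircular_quotient i j k l : scalar_curvature h x != 0 ->
  (concircular h x i j k l - riemann h x i j k l) / scalar_curvature h x
  = - (n%:R * (n%:R - 1))^-1 * (h x i l * h x j k - h x j l * h x i k).
Proof.
move=> S0; rewrite /concircular.
(* Generalizing 1 / (n (n - 1)) leaves S0 as the only side condition. *)
by move: (n%:R * (n%:R - 1))^-1 => r; field.
Qed.

Lemma riemann_sub_conharmonic i j k l : n%:R - 2 != 0 :> R ->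
  (n%:R - 2) * (riemann h x i j k l - conharmonic h x i j k l)
  = h x j k * ricci h x i l + h x i l * ricci h x j k
    - h x i k * ricci h x j l - h x j l * ricci h x i k.
Proof. by move=> n2; rewrite /conharmonic subKr mulVKf. Qed.

End CurvatureAlgebra.

Theorem theorem1 (R : realType) (n : nat) (hn : (3 <= n)%N)
    (M : topologicalType) (A : set (chart R n M)) (hM : smooth_manifold A)
    (I : set R) (hI : is_interval I)
    (hI_nondeg : exists a b, [/\ I a, I b & a < b])
    (g : chart R n M -> R -> 'rV[R]_n -> 'M[R]_n)
    (hg : smooth_metric_family A I g)
    (hflow : ricci_flow A I g)
    (hscal : forall c t x, A c -> I t -> chart_image c x ->
      scalar_curvature (g c t) x != 0)
    (c : chart R n M) (hc : A c) (t : R) (ht : I t)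
    (x : 'rV[R]_n) (hx : chart_image c x) (i j k l : 'I_n) :
  has_deriv_within I
    (fun s => (concircular (g c s) x i j k l - riemann (g c s) x i j k l)
              / scalar_curvature (g c s) x)
    t
    (2 * (n%:R - 2) / (n%:R * (n%:R - 1)) *
     (riemann (g c t) x i j k l - conharmonic (g c t) x i j k l)).
Proof.
have n2 : n%:R - 2 != 0 :> R.
  by rewrite subr_eq0 eqr_nat; apply: contraTneq hn => ->.
have dg a b : has_deriv_within I (fun s => g c s x a b) t
    (- 2 * ricci (g c t) x a b) by exact: hflow.
apply: has_deriv_within_eq ht _ _ => [s Is|].
  exact: concircular_quotient (hscal c s x hc Is hx).
have := has_deriv_withinZ (- (n%:R * (n%:R - 1))^-1)
  (has_deriv_withinB (has_deriv_withinM (dg i l) (dg j k))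
                     (has_deriv_withinM (dg j l) (dg i k))).
congr (has_deriv_within _ _ _ _).
rewrite [in RHS](mulrAC 2) -(mulrA _ (n%:R - 2)) riemann_sub_conharmonic//.
by ring.
Qed.
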